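(* Let $X$ be a coarse space and let $n\ge 0$ be an integer. The following conditions are equivalent: (a) $\mathrm{asdim}(X)\leq n$. (b) For every $\epsilon>0$ and every uniformly bounded cover $\mathcal{U}$ of $X$ there is a $(\mathcal{U},\epsilon)$-partition of unity $f\colon X\to K^{(n)}$ into the $n$-skeleton of some simplicial complex $K$. (c) For every uniformly bounded cover $\mathcal{U}$ of $X$ there is a $(\mathcal{U},\infty)$-partition of unity $f\colon X\to K^{(n)}$ into the $n$-skeleton of some simplicial complex $K$.
   Context: Coarse spaces. A coarse space is a set $X$ with a large scale structure: a nonempty collection of families of subsets of $X$, called uniformly bounded families, such that (1) if $\mathcal{B}_1$ is uniformly bounded and every element of $\mathcal{B}_2$ with more than one point is contained in some element of $\mathcal{B}_1$, then $\mathcal{B}_2$ is uniformly bounded; (2) if $\mathcal{B}_1,\mathcal{B}_2$ are uniformly bounded then so is $\{st(B,\mathcal{B}_2) : B\in\mathcal{B}_1\}$, where $st(B,\mathcal{B}_2)$ is the union of all elements of $\mathcal{B}_2$ intersecting $B$. (This is equivalent to Roe's coarse structures: $\mathcal{B}$ is uniformly bounded iff $\bigcup_{B\in\mathcal{B}}B\times B$ is controlled.) Asymptotic dimension. $\mathrm{asdim}(X)\le n$ means: for every uniformly bounded cover $\mathcal{U}$ of $X$ there is a uniformly bounded cover $\mathcal{V}$ of $X$ such that every element $U$ of $\mathcal{U}$ intersects at most $n+1$ elements of $\mathcal{V}$. Simplicial complexes. For a set $S$, the full complex $\Delta(S)$ is the set of finitely supported functions $f\colon S\to[0,1]$ with $\sum_{s\in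 S}f(s)=1$, with the metric inherited from $l^1(S)$. A simplicial complex $K$ is a subcomplex of some $\Delta(S)$, with the induced $l^1$-metric; $K^{(0)}$ is its set of vertices and $K^{(n)}$ its $n$-skeleton. The star $st(v)$ of a vertex $v$ is the set of all $f\in K$ with $f(v)>0$. Any function $f\colon X\to K$ is viewed as a point-finite partition of unity $\{f_v\}_{v\in K^{(0)}}$, $f_v(x):=f(x)(v)$. $(\mathcal{U},\epsilon)$-partitions of unity. For a cover $\mathcal{U}$ of $X$ and a function $f$ from $X$ to a metric space, $var_{\mathcal{U}}(f)$ is the supremum of $d(f(x),f(y))$ over all $x,y$ contained in a common element of $\mathcal{U}$. For $\epsilon\in(0,\infty]$, $f\colon X\to K$ is a $(\mathcal{U},\epsilon)$-partition of unity if: (i) $var_{\mathcal{U}}(f)<\epsilon$; (ii) for every $U\in\mathcal{U}$ there is $v\in K^{(0)}$ with $f_v(y)>0$ for all $y\in U$; (iii) $\{f^{-1}(st(v))\}_{v\in K^{(0)}}$ is a uniformly bounded cover of $X$. *)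

(* Defs.v *)
From HB Require Import structures.
From mathcomp Require Import all_boot all_order all_algebra.
From mathcomp Require Import all_classical all_reals ereal.

Set Implicit Arguments.
Unset Strict Implicit.
Unset Printing Implicit Defensive.

Import Order.TTheory GRing.Theory Num.Theory.

Local Open Scope classical_set_scope.
Local Open Scope card_scope.
Local Open Scope ring_scope.

Definition star (X : Type) (B : set X) (F : set (set X)) : set X :=
  \bigcup_(C in [set C | F C /\ C `&` B !=set0]) C.

Record coarseType : Type := CoarseType {
  coarse_sort :> Type;
  unif_bounded : set (set (set coarse_sort));
  unif_bounded_nonempty : unif_bounded !=set0;
  unif_bounded_refine : forall B1 B2 : set (set coarse_sort),
    unif_bounded B1 ->
    (forall B, B2 B -> (exists x y, [/\ B x, B y & x <> y]) ->
       exists2 C, B1 C & B `<=` C) ->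
    unif_bounded B2;
  unif_bounded_star : forall B1 B2 : set (set coarse_sort),
    unif_bounded B1 -> unif_bounded B2 ->
    unif_bounded [set star B B2 | B in B1] }.

Definition is_cover (X : Type) (F : set (set X)) : Prop :=
  \bigcup_(U in F) U = [set: X].

Definition unif_bounded_cover (X : coarseType) (F : set (set X)) : Prop :=
  unif_bounded F /\ is_cover F.

Definition asdim_le (X : coarseType) (n : nat) : Prop :=
  forall U : set (set X), unif_bounded_cover U ->
  exists V : set (set X), unif_bounded_cover V /\
    forall A, U A -> [set B | V B /\ A `&` B !=set0] #<= `I_n.+1.

Definition full_complex (R : realType) (S : choiceType) : set (S -> R) :=
  [set f | [/\ finite_set [set s | f s != 0],
               forall s, 0 <= f s <= 1 &
               \sum_(s \in [set: S]) f s = 1]].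

(* The closed face of the full complex spanned by A; empty when A is empty. *)
Definition face (R : realType) (S : choiceType) (A : set S) : set (S -> R) :=
  [set f | full_complex f /\ [set s | f s != 0] `<=` A].
Arguments face R {S} A.

Definition union_of_faces (R : realType) (S : choiceType)
    (K : set (S -> R)) : Prop :=
  exists F : set (set S), (forall A, F A -> finite_set A) /\
    K = \bigcup_(A in F) face R A.

Record simplicial_complex (R : realType) (S : choiceType) : Type :=
  SimplicialComplex {
    complex_points :> set (S -> R);
    complexP : union_of_faces complex_points }.

(* A vertex is identified with the corresponding element of S. *)
Definition vertices (R : realType) (S : choiceType)
    (K : simplicial_complex R S) : set S :=
  [set v | face R [set v] `<=` K].

Definition skeleton_points (R : realType) (S : choiceType) (n : nat)
    (K : simplicial_complex R S) : set (S -> R) :=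
  \bigcup_(A in [set A | A #<= `I_n.+1 /\ face R A `<=` K]) face R A.

Lemma skeleton_union_of_faces (R : realType) (S : choiceType) (n : nat)
    (K : simplicial_complex R S) : union_of_faces (skeleton_points n K).
Proof.
exists [set A | A #<= `I_n.+1 /\ face R A `<=` K]; split=> // A [cA _].
exact: card_le_finite cA (finite_II _).
Qed.

Definition skeleton (R : realType) (S : choiceType) (n : nat)
    (K : simplicial_complex R S) : simplicial_complex R S :=
  SimplicialComplex (skeleton_union_of_faces n K).

(* The finitary sum is 0 on infinite supports, so this is the l^1 distance only
   between finitely supported functions, such as points of a complex. *)
Definition l1_dist (R : realType) (S : choiceType) (f g : S -> R) : R :=
  \sum_(s \in [set: S]) `|f s - g s|.

Definition vertex_star (R : realType) (S : choiceType)
    (K : simplicial_complex R S) (v : S) : set (S -> R) :=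
  [set f | complex_points K f /\ 0 < f v].

Definition variation (R : realType) (X Y : Type) (d : Y -> Y -> R)
    (U : set (set X)) (f : X -> Y) : \bar R :=
  ereal_sup [set r | exists A x y,
    [/\ U A, A x, A y & r = (d (f x) (f y))%:E]].

Definition partition_of_unity (R : realType) (S : choiceType) (X : coarseType)
    (U : set (set X)) (eps : \bar R) (K : simplicial_complex R S)
    (f : X -> (S -> R)) : Prop :=
  [/\ forall x, complex_points K (f x),
      (variation (@l1_dist R S) U f < eps)%E,
      forall A, U A -> exists2 v, vertices K v & forall y, A y -> 0 < f y v &
      unif_bounded_cover [set f @^-1` vertex_star K v | v in vertices K]].

(* Main.v *)
Require Import Defs.
From HB Require Import structures.
From mathcomp Require Import all_boot all_order all_algebra.
From mathcomp Require Import all_classical all_reals ereal.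
From mathcomp Require Import finmap ring lra.

(** Given the dimension bound and a cover [U], measure distances along [U]: [x]
    is within [k] steps of [B] when it lies in the [k]-fold iterated [U]-star of
    [B].  Apply [asdim_le] to the balls of radius [m], getting a cover [V] such
    that every such ball meets at most [n + 1] members of [V].  Weight each [B]
    in [V] at [x] by [max (m + 1 - d(x, B)) 0], the number of [k <= m] such that
    [x] lies in the [k]-fold star of [B].  Only the members of [V] that meet the
    [m]-ball about [x] get a positive weight ([depth_gt0] and
    [iter_star_meets]), so at most [n + 1] of them; each weight is 1-Lipschitz
    along [U] ([depth_lipschitz]); and the total weight is at least [m + 1],
    since [x] lies in some member of [V] ([depth_inside]).  After division by
    the total, two points of a common member of [U] are at l^1 distance at most
    [2 * 2 (n + 1) / (m + 1)] ([l1_dist_normalize] and [l1_dist_le_card]), which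
    is less than [eps] for large [m].

    Going back to the dimension from a partition of unity without variation
    bound, the preimages of the vertex stars do not themselves form the required
    cover, as a member of [U] may meet many of them without being contained in
    them.  Starting from a partition of unity for the [U]-stars of the members
    of [U], shrink the preimage of the star of [v] to the points all of whose
    [U]-neighbours lie in it.  A member [A] of [U] that meets the shrunken set
    is contained in the original one, so [v] is in the support of [f y] for one
    fixed [y] in [A], and that support has at most [n + 1] elements.  The
    shrunken sets still cover because each [U]-star lies in one preimage. *)

Set Implicit Arguments.
Unset Strict Implicit.
Unset Printing Implicit Defensive.

Import Order.TTheory GRing.Theory Num.Theory.

Local Open Scope classical_set_scope.
Local Open Scope card_scope.
Local Open Scope ring_scope.

(** * Iterated stars *)

Definition iter_star (X : Type) (U : set (set X)) (k : nat) (B : set X) :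
  set X := iter k (fun C => star C U) B.

Lemma coverP (X : Type) (U : set (set X)) (x : X) :
  is_cover U -> exists2 A, U A & A x.
Proof. by move=> cU; have : [set: X] x by []; rewrite -cU. Qed.

(** Both sides say that some member of [U] meets both [B] and [C]. *)
Lemma star_meets (X : Type) (U : set (set X)) (B C : set X) :
  star B U `&` C !=set0 -> B `&` star C U !=set0.
Proof.
move=> [x [[D [UD [y [Dy By]]] Dx] Cx]].
by exists y; split=> //; exists D => //; split=> //; exists x.
Qed.

(** The symmetry of the distance along [U]: the members of a cover that come
    within [k] steps of [x] are those met by the ball of radius [k] about [x]. *)
Lemma iter_star_meets (X : Type) (U : set (set X)) (k : nat) (B C : set X) :
  iter_star U k B `&` C !=set0 -> B `&` iter_star U k C !=set0.
Proof.
elim: k B C => [//|k IH] B C /= /star_meets/IH.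
by rewrite -[_ (star C U)]iterSr.
Qed.

Lemma iter_star_adjacent (X : Type) (U : set (set X)) (k : nat)
    (A B : set X) (x y : X) :
  U A -> A x -> A y -> iter_star U k B x -> iter_star U k.+1 B y.
Proof. by move=> UA Ax Ay Bx; exists A => //; split=> //; exists x. Qed.

Lemma iter_star_mono (X : Type) (U : set (set X)) (i j : nat) (B : set X) :
  is_cover U -> (i <= j)%N -> iter_star U i B `<=` iter_star U j B.
Proof.
move=> cU /subnK <-; elim: (j - i)%N => [//|k IH] x /IH Bx.
have [A UA Ax] := coverP x cU.
exact: (iter_star_adjacent UA Ax).
Qed.

Lemma unif_bounded_iter_star (X : coarseType) (U F : set (set X)) (k : nat) :
  unif_bounded U -> unif_bounded F ->
  unif_bounded [set iter_star U k B | B in F].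
Proof.
move=> bU bF; elim: k => [|k IH].
  apply: unif_bounded_refine bF _ => _ [B FB <-] _; by exists B.
have := unif_bounded_star IH bU; rewrite image_comp; exact.
Qed.

(** The refinement axiom ignores sets with at most one point. *)
Lemma unif_bounded_singletons (X : coarseType) :
  unif_bounded [set [set x] | x in [set: X]].
Proof.
have [F bF] := unif_bounded_nonempty X.
by apply: unif_bounded_refine bF _ => _ [x _ <-] [y [z [-> ->]]].
Qed.

(** * Depth in the neighbourhood of a set *)

(** This is [max (m - d(x, B)) 0] for [d] the distance along a cover [U].
    Counting stars keeps it a natural number, well defined also when no chain of
    members of [U] joins [x] to [B]. *)
Definition depth (X : Type) (U : set (set X)) (m : nat) (B : set X) (x : X) :
  nat := (\sum_(k < m) `[< iter_star U k B x >])%N.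

Lemma depth_gt0 (X : Type) (U : set (set X)) (m : nat) (B : set X) (x : X) :
  is_cover U -> (0 < depth U m.+1 B x)%N -> iter_star U m B x.
Proof.
move=> cU; apply: contraPP => nBx; rewrite /depth big1// => k _.
by rewrite asboolF// => /(iter_star_mono cU (leq_ord k)).
Qed.

Lemma depth_inside (X : Type) (U : set (set X)) (m : nat) (B : set X) (x : X) :
  is_cover U -> B x -> depth U m B x = m.
Proof.
move=> cU Bx; rewrite /depth (eq_bigr (fun=> 1%N)) ?sum1_card ?card_ord// => k _.
by rewrite asboolT//; exact: (@iter_star_mono _ _ 0%N).
Qed.

(** If the [k]-fold star contains [x] then the next one contains [y], so the
    count at [y] starts at most one step later. *)
Lemma depth_lipschitz (X : Type) (U : set (set X)) (m : nat) (A B : set X)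
    (x y : X) :
  U A -> A x -> A y -> (depth U m B x <= (depth U m B y).+1)%N.
Proof.
move=> UA Ax Ay; rewrite /depth.
apply: (@leq_trans (\sum_(k < m) `[< iter_star U k.+1 B y >])).
  apply: leq_sum => k _; case: asboolP => // Bx.
  by rewrite asboolT//; exact: iter_star_adjacent UA Ax Ay Bx.
apply: (@leq_trans (\sum_(k < m.+1) `[< iter_star U k B y >])).
  by rewrite big_ord_recl leq_addl.
by rewrite big_ord_recr /= -addn1 leq_add2l leq_b1.
Qed.

(** * Normalization onto the full complex *)

Definition normalize (R : realType) (S : choiceType) (h : S -> R) (s : S) : R :=
  h s / \sum_(t \in [set: S]) h t.

Lemma notin_support (R : realType) (S : choiceType) (h : S -> R) (s : S) :
  finite_set [set t | h t != 0] -> s \notin fset_set [set t | h t != 0] ->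
  h s = 0.
Proof. by move=> fh; rewrite in_fset_set // notin_setE /= => /negP/negPn/eqP. Qed.

Lemma full_complex_normalize (R : realType) (S : choiceType) (h : S -> R) :
  finite_set [set s | h s != 0] -> (forall s, 0 <= h s) ->
  0 < \sum_(s \in [set: S]) h s -> full_complex (normalize h).
Proof.
move=> fh h0 H0.
have sumE : \sum_(s \in [set: S]) normalize h s = 1.
  by rewrite -mulr_fsuml divff ?gt_eqF.
have n0 s : 0 <= normalize h s by rewrite divr_ge0 // ltW.
have fn : finite_set [set s | normalize h s != 0].
  apply: sub_finite_set fh => s /=; apply: contraNN => /eqP hs.
  by rewrite /normalize hs mul0r.
split=> // s; rewrite n0 /= -sumE.
rewrite (fsbigTE (s |` fset_set [set t | normalize h t != 0])%fset).
  rewrite (big_fsetD1 s) ?inE ?eqxx //= lerDl; apply: sumr_ge0 => t _; exact: n0.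
by move=> t; rewrite inE negb_or => /andP[_ /(notin_support fn)].
Qed.

(** Change [g / G] into [h / G], then [h / G] into [h / H], where [G] and [H] are
    the sums of [g] and [h].  The first change costs [l1_dist g h / G]; the
    second costs [|H - G| / G], which is no more than the first. *)
Lemma l1_dist_normalize (R : realType) (S : choiceType) (g h : S -> R) :
  finite_set [set s | g s != 0] -> finite_set [set s | h s != 0] ->
  (forall s, 0 <= h s) ->
  0 < \sum_(s \in [set: S]) g s -> 0 < \sum_(s \in [set: S]) h s ->
  l1_dist (normalize g) (normalize h) <=
    2 * l1_dist g h / \sum_(s \in [set: S]) g s.
Proof.
move=> fg fh h0.
rewrite /l1_dist /normalize.
set G := \sum_(s \in _) g s; set H := \sum_(s \in _) h s => G0 H0.
pose D := (fset_set [set s | (g s != 0)] `|` fset_set [set s | (h s != 0)])%fset.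
have outD s : s \notin D -> g s = 0 /\ h s = 0.
  by rewrite inE negb_or => /andP[/(notin_support fg) + /(notin_support fh)].
have GE : G = \sum_(s <- D) g s by apply: (fsbigTE D) => s /outD[].
have HE : H = \sum_(s <- D) h s by apply: (fsbigTE D) => s /outD[].
have -> : \sum_(s \in [set: S]) `|g s - h s| = \sum_(s <- D) `|g s - h s|.
  by apply: (fsbigTE D) => s /outD[-> ->]; rewrite subr0 normr0.
have -> : \sum_(s \in [set: S]) `|g s / G - h s / H| =
          \sum_(s <- D) `|g s / G - h s / H|.
  by apply: (fsbigTE D) => s /outD[-> ->]; rewrite !mul0r subr0 normr0.
set d := \sum_(s <- D) `|g s - h s|.
have GHd : `|H - G| <= d.
  by rewrite distrC GE HE -sumrB; exact: ler_norm_sum.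
have termwise s : `|g s / G - h s / H| <= `|g s - h s| / G + h s * `|G^-1 - H^-1|.
  have -> : g s / G - h s / H = (g s - h s) / G + h s * (G^-1 - H^-1) by ring.
  apply: le_trans (ler_normD _ _) _.
  by rewrite !normrM (ger0_norm (h0 s)) (@ger0_norm _ G^-1) // invr_ge0 ltW.
apply: le_trans (ler_sum _ (fun s _ => termwise s)) _.
rewrite big_split /= -!mulr_suml -HE -/d.
have -> : H * `|G^-1 - H^-1| = `|H - G| / G.
  rewrite -{1}(gtr0_norm H0) -normrM.
  have -> : H * (G^-1 - H^-1) = (H - G) / G by field; rewrite !gt_eqF.
  by rewrite normrM (@ger0_norm _ G^-1) // invr_ge0 ltW.
have -> : 2 * d / G = d / G + d / G by ring.
by rewrite lerD2l ler_pM2r // invr_gt0.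
Qed.

(** Only indices in the union of the two supports contribute. *)
Lemma l1_dist_le_card (R : realType) (S : choiceType) (n : nat) (g h : S -> R) :
  [set s | g s != 0] #<= `I_n -> [set s | h s != 0] #<= `I_n ->
  (forall s, `|g s - h s| <= 1) -> l1_dist g h <= (n + n)%:R.
Proof.
move=> cg ch gh1.
have fg := card_le_finite cg (finite_II _).
have fh := card_le_finite ch (finite_II _).
pose D := (fset_set [set s | (g s != 0)] `|` fset_set [set s | (h s != 0)])%fset.
have -> : l1_dist g h = \sum_(s <- D) `|g s - h s|.
  apply: (fsbigTE D) => s; rewrite inE negb_or.
  by case/andP=> /(notin_support fg)-> /(notin_support fh)->; rewrite subrr normr0.
apply: le_trans (ler_sum _ (fun s _ => gh1 s)) _.
rewrite big_const_seq count_predT iter_addr_0 ler_nat.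
rewrite cardfsU (leq_trans (leq_subr _ _))//.
by rewrite leq_add // geq_card_fset_set.
Qed.

(** * The full simplicial complex *)

Lemma full_union_of_faces (R : realType) (S : choiceType) :
  union_of_faces (@full_complex R S).
Proof.
exists (@finite_set S); split=> //; apply/seteqP; split=> [f Kf|f [A _ []]//].
by exists [set s | f s != 0]; [case: Kf|split].
Qed.

Definition full_simplicial_complex (R : realType) (S : choiceType) :
  simplicial_complex R S := SimplicialComplex (@full_union_of_faces R S).

Lemma skeleton_full (R : realType) (S : choiceType) (n : nat) (f : S -> R) :
  full_complex f -> [set s | f s != 0] #<= `I_n.+1 ->
  complex_points (skeleton n (full_simplicial_complex R S)) f.
Proof.
by move=> Kf cf; exists [set s | f s != 0] => //; split=> // g [].
Qed.

Lemma vertices_skeleton_full (R : realType) (S : choiceType) (n : nat) :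
  vertices (skeleton n (full_simplicial_complex R S)) = [set: S].
Proof.
apply/seteqP; split=> // v _ f /= fv; exists [set v] => //; split=> [|g []//].
by rewrite (card_le_eql card_set1) card_le_II.
Qed.

Lemma skeleton_support (R : realType) (S : choiceType) (n : nat)
    (K : simplicial_complex R S) (f : S -> R) :
  complex_points (skeleton n K) f -> [set s | f s != 0] #<= `I_n.+1.
Proof.
by move=> [A [cA _] [_ fA]]; apply: card_le_trans cA; exact: subset_card_le.
Qed.

(** * From asymptotic dimension to partitions of unity and back *)

(** The vertices are all subsets of [X], so that there is a vertex even when [X]
    is empty; subsets outside [V] get weight 0 and hence empty preimages. *)
Lemma asdim_le_partition_of_unity (R : realType) (X : coarseType) (n : nat)
    (eps : R) (U : set (set X)) :
  asdim_le X n -> 0 < eps -> unif_bounded_cover U ->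
  exists (S : choiceType) (K : simplicial_complex R S) (f : X -> S -> R),
    partition_of_unity U eps%:E (skeleton n K) f.
Proof.
move=> dimX eps0 [bU cU].
pose bnd := 4 * n.+1%:R / eps.
have [m0 m0_big] : exists m0 : nat, bnd < m0%:R.
  by exists (Num.bound bnd); apply: archi_boundP; rewrite divr_ge0 // ?ltW // mulr_ge0.
(* [m >= 1] is what makes the weight of [B] at points of [B], namely [m + 1],
   exceed the Lipschitz bound 1. *)
pose m := m0.+1.
have [|V [[bV cV] Vmeets]] :=
    dimX [set iter_star U m B | B in [set [set x] | x in setT]].
  split; first exact: unif_bounded_iter_star (unif_bounded_singletons X).
  apply/seteqP; split=> // x _; exists (iter_star U m [set x]).
    by exists [set x] => //; exists x.
  exact: (@iter_star_mono _ _ 0%N).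
pose w (x : X) (B : set X) : R := (`[< V B >] * depth U m.+1 B x)%:R.
have w_supp x : [set B | w x B != 0] #<= `I_n.+1.
  apply: card_le_trans (Vmeets (iter_star U m [set x]) _); last first.
    by exists [set x] => //; exists x.
  apply: subset_card_le => B /=; rewrite pnatr_eq0 muln_eq0 negb_or -!lt0n.
  rewrite lt0b => /andP[/asboolP VB /(depth_gt0 cU) Bx]; split=> //.
  by rewrite setIC; apply: (@iter_star_meets _ _ m); exists x.
have w_fin x := card_le_finite (w_supp x) (finite_II _).
have w_ge0 x B : 0 <= w x B by [].
have w_in x B : V B -> B x -> w x B = m.+1%:R.
  by move=> VB Bx; rewrite /w asboolT // mul1n depth_inside.
have w_lip A x y B : U A -> A x -> A y -> `|w x B - w y B| <= 1.
  move=> UA Ax Ay; rewrite ler_distl /w; case: asboolP => _; last first.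
    by rewrite !mul0n; lra.
  by rewrite !mul1n lerBlDr !natr1 !ler_nat !(depth_lipschitz _ _ UA).
pose tot x := \sum_(B \in [set: set X]) w x B.
have tot_ge x : m.+1%:R <= tot x.
  have [B VB Bx] := coverP x cV.
  rewrite /tot (fsbigTE (B |` fset_set [set C | w x C != 0])%fset); last first.
    by move=> C; rewrite inE negb_or => /andP[_ /(notin_support (w_fin x))].
  by rewrite (big_fsetD1 B) ?inE ?eqxx //= w_in // lerDl sumr_ge0.
have tot_gt0 x : 0 < tot x by exact: lt_le_trans (tot_ge x).
have f_gt0 x B : (0 < normalize (w x) B) = (0 < w x B).
  by rewrite /normalize pmulr_lgt0 // invr_gt0; exact: tot_gt0.
have f_supp x : [set B | normalize (w x) B != 0] #<= `I_n.+1.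
  apply: card_le_trans (w_supp x); apply: subset_card_le => B /=.
  by apply: contraNN => /eqP wB; rewrite /normalize wB mul0r.
exists (set X), (full_simplicial_complex R (set X)), (fun x => normalize (w x)).
have Kf x : complex_points (skeleton n (full_simplicial_complex R (set X)))
    (normalize (w x)).
  apply: skeleton_full => //.
  exact: full_complex_normalize (w_fin x) (w_ge0 x) (tot_gt0 x).
split=> [//| | |].
- apply: (@le_lt_trans _ _ (bnd * eps / m.+1%:R)%:E).
    apply: ge_ereal_sup => _ [A [x [y [UA Ax Ay ->]]]]; rewrite lee_fin.
    have := l1_dist_normalize (w_fin x) (w_fin y) (w_ge0 y) (tot_gt0 x) (tot_gt0 y).
    move=> /le_trans; apply.
    have lw : l1_dist (w x) (w y) <= (n.+1 + n.+1)%:R.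
      by apply: l1_dist_le_card => // B; exact: w_lip UA Ax Ay.
    apply: ler_pM.
    + by rewrite mulr_ge0 // fsumr_ge0.
    + by rewrite invr_ge0 ltW //; exact: tot_gt0.
    + by rewrite /bnd divfK ?gt_eqF //; move: lw; rewrite natrD; lra.
    + by rewrite lef_pV2 ?posrE // -/(tot x).
  rewrite lte_fin ltr_pdivrMr // mulrC ltr_pM2l //; apply: lt_trans m0_big _.
  by rewrite ltr_nat.
- (* A member [B] of [V] containing one point of [A] serves for all of [A]: the
     weight of [B] is [m + 1 >= 2] there, hence at least 1 throughout [A]. *)
  move=> A UA; rewrite vertices_skeleton_full.
  have [->|/set0P[x Ax]] := eqVneq A set0; [by exists set0|].
  have [B VB Bx] := coverP x cV.
  exists B => // y Ay; rewrite f_gt0.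
  have := w_lip A x y B UA Ax Ay; rewrite w_in // ler_distl.
  have : 2 <= m.+1%:R :> R by rewrite ler_nat.
  lra.
rewrite vertices_skeleton_full; split.
  apply: unif_bounded_refine (unif_bounded_iter_star m bU bV) _.
  move=> _ [B _ <-] [x0 [_ [[_ + _ _]]]]; rewrite f_gt0 ltr0n muln_gt0 lt0b.
  move=> /andP[/asboolP VB _]; exists (iter_star U m B); first by exists B.
  by move=> x [_]; rewrite f_gt0 ltr0n muln_gt0 => /andP[_ /(depth_gt0 cU)].
apply/seteqP; split=> // x _; have [B VB Bx] := coverP x cV.
eexists; first by exists B.
by split=> //; rewrite f_gt0 w_in.
Qed.

(** The hypothesis is applied to the cover by the [U]-stars of members of [U], so
    that the whole [U]-star of a point lies in the preimage of one vertex star;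
    this is what lets the preimages be shrunk to [core v] and still cover. *)
Lemma partition_of_unity_asdim_le (R : realType) (X : coarseType) (n : nat) :
  (forall U : set (set X), unif_bounded_cover U ->
     exists (S : choiceType) (K : simplicial_complex R S) (f : X -> S -> R),
       partition_of_unity U +oo%E (skeleton n K) f) ->
  asdim_le X n.
Proof.
move=> pou U [bU cU].
have [|S [K [f [Kf _ lebesgue [bW _]]]]] := pou [set star A U | A in U].
  split; first exact: unif_bounded_star.
  apply/seteqP; split=> // x _; have [A UA Ax] := coverP x cU.
  exists (star A U); first by exists A.
  by exists A => //; split=> //; exists x.
pose core v := [set x | forall A, U A -> A x -> forall y, A y -> 0 < f y v].
exists [set core v | v in vertices (skeleton n K)]; split; [split|].
- apply: unif_bounded_refine bW _ => _ [v Kv <-] _.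
  eexists; first by exists v.
  move=> x vx; split=> //; have [A UA Ax] := coverP x cU.
  exact: (vx A UA Ax).
- apply/seteqP; split=> // x _; have [A UA Ax] := coverP x cU.
  have [|v Kv fv] := lebesgue (star A U); first by exists A.
  exists (core v); first by exists v.
  by move=> C UC Cx y Cy; apply: fv; exists C => //; split=> //; exists x.
move=> A UA; have [->|/set0P[y Ay]] := eqVneq A set0.
  rewrite (_ : [set _ | _] = set0) ?card_ge0 //.
  by apply/seteqP; split=> // B [_ [x []]].
apply: card_le_trans (skeleton_support (Kf y)).
apply: card_le_trans (card_image_le core _); apply: subset_card_le.
move=> _ [[v Kv <-] [x [Ax vx]]]; exists v => //=.
by rewrite gt_eqF //; exact: vx UA Ax y Ay.
Qed.

Theorem theorem4p2 (R : realType) (X : coarseType) (n : nat) :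
  [<-> asdim_le X n;
       forall (eps : R) (U : set (set X)), 0 < eps -> unif_bounded_cover U ->
         exists (S : choiceType) (K : simplicial_complex R S) (f : X -> S -> R),
           partition_of_unity U eps%:E (skeleton n K) f;
       forall U : set (set X), unif_bounded_cover U ->
         exists (S : choiceType) (K : simplicial_complex R S) (f : X -> S -> R),
           partition_of_unity U +oo%E (skeleton n K) f].
Proof.
tfae.
- by move=> dimX eps U; exact: asdim_le_partition_of_unity.
- move=> pou U cU; have [S [K [f [Kf vf lf cf]]]] := pou 1 U ltr01 cU.
  by exists S, K, f; split=> //; exact: lt_trans vf (ltry 1).
exact: partition_of_unity_asdim_le.
Qed.
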